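(* Let $b$ and $m$ be positive integers. If $m$ divides $b+1$ and $\operatorname{cosocle}(m)>\operatorname{rad}(b)$, then $(1,b^{k},b^{k}+1)$ is an $abc$ triple for each positive odd integer $k$.
   Context: For a positive integer $n$, $\operatorname{rad}(n)$ denotes the product of the distinct prime factors of $n$ (with $\operatorname{rad}(1)=1$), and $\operatorname{cosocle}(n)=\frac{n}{\operatorname{rad}(n)}$. An $abc$ triple is a triple $(a,b,c)$ of relatively prime positive integers with $a+b=c$ and $\operatorname{rad}(abc)<c$. *)

(* Defs.v *)
From mathcomp Require Import all_boot.

Set Implicit Arguments.
Unset Strict Implicit.
Unset Printing Implicit Defensive.

Definition rad (n : nat) : nat := \prod_(p <- primes n) p.

(* Makes the truncated division in [cosocle] exact. *)
Lemma rad_dvdn (n : nat) : 0 < n -> rad n %| n.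
Proof.
move=> n_gt0; rewrite {2}(prod_prime_decomp n_gt0) prime_decompE big_map /=.
rewrite /rad !big_seq; elim/big_ind2: _ => // [a b c d|p]; first exact: dvdn_mul.
by rewrite -logn_gt0; case: (logn p n) => // e _; rewrite expnS dvdn_mulr.
Qed.

Definition cosocle (n : nat) : nat := n %/ rad n.

(* Coprimality is that of the triple, gcd(a, b, c) = 1; since a + b = c, this is
   the same as pairwise coprimality. *)
Definition abc_triple (a b c : nat) : Prop :=
  [/\ [/\ 0 < a, 0 < b & 0 < c],
      gcdn (gcdn a b) c = 1,
      a + b = c
    & rad (a * b * c) < c].

(* Main.v *)
(* Since k is odd, m divides c := b^k + 1, say c = m q.  As rad is
   submultiplicative, rad (b^k c) <= rad b * rad m * q, and this is smaller than
   cosocle m * rad m * q = m q = c. *)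
Require Import Defs.
From mathcomp Require Import all_boot.

(** Multiplying [cosocle m > rad b] by [rad m] gives [rad b * rad m < m]. For odd [k], [b + 1] and
    hence [m] divides [b ^ k + 1] ([dvdn_add1_expn_odd]), which is therefore [q * m]. The power
    contributes only [rad b] ([radX]) and the cofactor [q] at most [q], so [radM_leq] bounds the
    radical of the triple by [q * (rad b * rad m) < q * m]. *)

Lemma rad_gt0 n : 0 < rad n.
Proof.
rewrite /rad big_seq; apply: prodn_cond_gt0 => p.
by rewrite mem_primes => /and3P[/prime_gt0].
Qed.

Lemma dvdn_rad p n : p \in primes n -> p %| rad n.
Proof. by move=> pn; rewrite /rad (big_rem p) //= dvdn_mulr. Qed.

(** Distinct primes are pairwise coprime, so their product divides whatever each of them divides.
    The induction runs over an arbitrary duplicate-free list of primes. *)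
Lemma rad_dvdn_primes n d : {in primes n, forall p, p %| d} -> rad n %| d.
Proof.
have: all prime (primes n) by apply/allP => p; rewrite mem_primes => /andP[].
have := primes_uniq n; rewrite /rad.
elim: (primes n) => [|p s IHs] /=; first by rewrite big_nil dvd1n.
move=> /andP[ps us] /andP[p_pr s_pr] sd; rewrite big_cons Gauss_dvd.
  rewrite sd ?mem_head //= IHs // => q qs.
  by rewrite sd // in_cons qs orbT.
rewrite big_seq; apply: (big_ind (coprime p)) => [|x y|q qs].
- by rewrite coprimen1.
- by rewrite coprimeMr => -> ->.
- rewrite prime_coprime // dvdn_prime2 // ?(allP s_pr) //.
  by apply: contraNneq ps => ->.
Qed.

Lemma rad_leq n : 0 < n -> rad n <= n.
Proof. by move=> n_gt0; rewrite dvdn_leq ?rad_dvdn. Qed.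

(** Each prime of [x * y] divides [rad x] or [rad y], so the left side even divides the right. *)
Lemma radM_leq x y : 0 < x -> 0 < y -> rad (x * y) <= rad x * rad y.
Proof.
move=> x_gt0 y_gt0; rewrite dvdn_leq ?muln_gt0 ?rad_gt0 //.
apply: rad_dvdn_primes => p; rewrite primesM // => /orP[] /dvdn_rad.
  exact: dvdn_mulr.
exact: dvdn_mull.
Qed.

Lemma radX n k : 0 < k -> rad (n ^ k) = rad n.
Proof. by move=> k_gt0; rewrite /rad primesX. Qed.

Lemma dvdn_add1_expn_odd b k : odd k -> b + 1 %| b ^ k + 1.
Proof.
move=> k_odd; rewrite -(odd_double_half k) k_odd.
elim: k./2 => [|j IHj]; first by rewrite expn1.
rewrite doubleS -[true + _]/(true + j.*2).+2 2!expnS; set e := b ^ _ in IHj *.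
(* Adding a multiple of [b + 1] avoids subtraction: the sum regroups as another multiple of [b + 1]
   plus [e + 1], which the induction hypothesis covers. *)
rewrite -(@dvdn_addl (e * (b + 1))) ?dvdn_mull //.
suff -> : b * (b * e) + 1 + e * (b + 1) = b * e * (b + 1) + (e + 1).
  by rewrite dvdn_addr // dvdn_mull.
by rewrite !mulnDr !muln1 addnACA [e * b]mulnC [b * e * b]mulnC [1 + e]addnC.
Qed.

Theorem theorem2 (b m : nat) (hb : 0 < b) (hm : 0 < m)
  (hdvd : m %| b + 1) (hcos : cosocle m > rad b) :
  forall k : nat, 0 < k -> odd k -> abc_triple 1 (b ^ k) (b ^ k + 1).
Proof.
move=> k k_gt0 k_odd.
have bk_gt0 : 0 < b ^ k by rewrite expn_gt0 hb.
split; [by rewrite addn1 | by rewrite gcd1n gcd1n | by rewrite addnC |].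
have /dvdnP[q def_c] := dvdn_trans hdvd (dvdn_add1_expn_odd b k k_odd).
have q_gt0 : 0 < q by case: q def_c => //; rewrite addn1.
rewrite mul1n def_c mulnC.
have rad_qm : rad (q * m) <= q * rad m.
  by apply: leq_trans (radM_leq q m q_gt0 hm) _; rewrite leq_mul2r rad_leq ?orbT.
(* This is [hcos] times [rad m]; [cosocle m * rad m] is exactly [m] because [rad m] divides [m]. *)
have lt_m : rad b * rad m < m.
  by rewrite -{2}(divnK (rad_dvdn hm)) ltn_mul2r rad_gt0.
apply: leq_ltn_trans (radM_leq _ _ _ bk_gt0) _; first by rewrite muln_gt0 q_gt0.
rewrite radX //; apply: leq_ltn_trans (leq_mul rad_qm (leqnn _)) _.
by rewrite -mulnA ltn_mul2l q_gt0 mulnC.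
Qed.
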